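(* Let $A=(a_{ij})\in\mathbb{R}^{[m]\times[n]}$, and suppose at least one of the following holds: (i) $m\le 3$; (ii) $n\le 2$; (iii) $m=4$ and $n=3$. If $A$ does not have a forbidden pattern, then $A$ is universally connected.
   Context: Fix a positive integer $d$ and let $D=\{0,1,\dots,d\}$; write $[k]=\{1,\dots,k\}$. For $A\in\mathbb{R}^{[m]\times[n]}$ and $b\in\mathbb{R}^{[m]}$, the set of feasible solutions is $R(A,b)=\{x\in D^{[n]}: Ax\ge b\}$. The solution graph $G(A,b)$ is the undirected graph with vertex set $R(A,b)$ in which $x,y$ are adjacent iff they differ in exactly one coordinate (Hamming distance $1$). $A$ is universally connected if $G(A,b)$ is connected for every $b\in\mathbb{R}^{[m]}$. A pair $(I,J)$ with $I\subseteq[m]$, $J\subseteq[n]$, $|I|=|J|=\lambda\neq 0$, is a forbidden pattern in $A$ if there are orderings $I=\{i_1,\dots,i_\lambda\}$, $J=\{j_1,\dots,j_\lambda\}$ such that, with $i_{\lambda+1}:=i_1$, for every $\ell\in[\lambda]$: $a_{ij_\ell}=0$ for all $i\in I\setminus\{i_\ell,i_{\ell+1}\}$, and $a_{i_\ell j_\ell}a_{i_{\ell+1}j_\ell}<0$. ''$A$ has a forbidden pattern'' means some such $(I,J)$ exists. *)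

(* Defs.v *)
From mathcomp Require Import all_boot all_order all_algebra.
From mathcomp Require Import reals.

Set Implicit Arguments.
Unset Strict Implicit.
Unset Printing Implicit Defensive.

Import Order.TTheory GRing.Theory Num.Theory.
Local Open Scope ring_scope.

(* [D = {0, ..., d}] is ['I_d.+1]; the index sets [m] and [n] are 0-based. *)
Definition point (d n : nat) := {ffun 'I_n -> 'I_d.+1}.

Definition col_of_point (R : realType) (d n : nat) (x : point d n) : 'cV[R]_n :=
  \col_j ((x j : nat)%:R).

Definition feasible (R : realType) (d m n : nat)
    (A : 'M[R]_(m, n)) (b : 'cV[R]_m) : {set point d n} :=
  [set x | [forall i, b i 0 <= (A *m col_of_point R x) i 0]].

Definition hamming (d n : nat) (x y : point d n) : nat :=
  #|[set j | x j != y j]|.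

(* The membership tests keep paths inside the vertex set [feasible d A b]. *)
Definition solution_graph (R : realType) (d m n : nat)
    (A : 'M[R]_(m, n)) (b : 'cV[R]_m) : rel (point d n) :=
  fun x y => [&& x \in feasible d A b, y \in feasible d A b
               & hamming x y == 1%N].

(* An empty solution graph counts as connected. *)
Definition solution_graph_connected (R : realType) (d m n : nat)
    (A : 'M[R]_(m, n)) (b : 'cV[R]_m) : Prop :=
  {in feasible d A b &, forall x y, connect (@solution_graph R d m n A b) x y}.

Definition universally_connected (R : realType) (d m n : nat)
    (A : 'M[R]_(m, n)) : Prop :=
  forall b : 'cV[R]_m, solution_graph_connected d A b.

(* [i] and [j] are the orderings of [I] and [J]; [ordS] is the cyclic
   successor on ['I_lam], so that the index following the last is the first. *)
Definition forbidden_pattern (R : realType) (m n : nat) (A : 'M[R]_(m, n))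
    (I : {set 'I_m}) (J : {set 'I_n}) : Prop :=
  exists lam : nat, [/\ lam != 0%N, #|I| = lam, #|J| = lam &
    exists (i : 'I_lam -> 'I_m) (j : 'I_lam -> 'I_n),
      [/\ injective i, i @: [set: 'I_lam] = I,
          injective j, j @: [set: 'I_lam] = J &
          forall l : 'I_lam,
            (forall k, k \in I :\: [set i l; i (ordS l)] -> A k (j l) = 0) /\
            A (i l) (j l) * A (i (ordS l)) (j l) < 0]].

Definition has_forbidden_pattern (R : realType) (m n : nat)
    (A : 'M[R]_(m, n)) : Prop :=
  exists (I : {set 'I_m}) (J : {set 'I_n}), forbidden_pattern A I J.

(* Main.v *)
(** Join two feasible points [x], [y] by moving one coordinate of [x] at a time
    to its value in [y].  If no such move keeps feasibility, then for every
    coordinate [j] with [x j != y j] some row has a negative [j]-th and a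
    positive [k]-th term in [A (y - x)], for another such coordinate [k]; write
    [j -> k].  Every vertex of this digraph has an out-neighbour, so the digraph
    has a shortest directed cycle.  That cycle is chordless, which forces the
    rows that realise its edges to vanish at its other columns: these rows and
    columns form a forbidden pattern. *)
Require Import Defs.
From mathcomp Require Import all_boot all_order all_algebra.
From mathcomp Require Import reals.
From mathcomp Require Import zify.

Set Implicit Arguments.
Unset Strict Implicit.
Unset Printing Implicit Defensive.

Import Order.TTheory GRing.Theory Num.Theory.

Section ChordlessCycle.

Variables (T : finType) (e : rel T).

Let closed_walk (L : nat) (f : {ffun 'I_L -> T}) :=
  [forall l, e (f l) (f (ordS l))].

Let has_closed_walk (L : nat) :=
  (0 < L) && [exists f : {ffun 'I_L -> T}, closed_walk f].

Let closed_walk_of_nat (L : nat) (g : nat -> T) :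
  0 < L -> (forall t, t.+1 < L -> e (g t) (g t.+1)) -> e (g L.-1) (g 0) ->
  has_closed_walk L.
Proof.
move=> L_gt0 step back; rewrite /has_closed_walk L_gt0 /=.
apply/existsP; exists [ffun l : 'I_L => g l]; apply/forallP => l.
rewrite !ffunE /=; have := ltn_ord l; rewrite leq_eqVlt => /orP[/eqP lL|lL].
  by rewrite lL modnn -[val l]/(l.+1.-1) lL.
by rewrite modn_small //; apply: step.
Qed.

(** Iterating a choice of successors from [x0] must repeat a vertex, as [T] is finite; the stretch
    between two visits closes up. *)
Let exists_closed_walk (S : {pred T}) (x0 : T) :
  x0 \in S -> (forall x, x \in S -> exists2 y, y \in S & e x y) ->
  exists L, has_closed_walk L.
Proof.
move=> Sx0 succ_ex.
have /fin_all_exists[s sP] : forall x, exists y, x \in S -> y \in S /\ e x y.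
  move=> x; case: (boolP (x \in S)) => [/succ_ex[y Sy exy]|_].
    by exists y.
  by exists x.
pose g t := iter t s x0.
have Sg t : g t \in S by elim: t => //= t IH; case: (sP _ IH).
have eg t : e (g t) (g t.+1) by case: (sP _ (Sg t)).
have [u [v [ltuv guv]]] : exists u v : nat, u < v /\ g u = g v.
  have : ~~ injectiveb (fun t : 'I_#|T|.+1 => g t).
    apply/negP => /injectiveP /leq_card.
    by rewrite card_ord ltnn.
  case/injectivePn => u [v neq_uv guv].
  have : val u != val v by [].
  rewrite neq_ltn => /orP[lt|lt]; first by exists u, v.
  by exists v, u.
exists (v - u); apply: (closed_walk_of_nat (g := fun t => g (u + t))).
- by rewrite subn_gt0.
- by move=> t _; rewrite addnS.
- have := eg (u + (v - u).-1).
  by rewrite addn0 guv; congr (e _ (g _)); lia.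
Qed.

(** A closed walk of least length works: a repeated vertex or a chord would cut off a shorter one.
    Loops count, so [L] may be 1. *)
Lemma exists_chordless_cycle (S : {pred T}) (x0 : T) :
  x0 \in S -> (forall x, x \in S -> exists2 y, y \in S & e x y) ->
  exists L (f : 'I_L -> T), [/\ 0 < L, injective f,
    forall l, e (f l) (f (ordS l)) & forall u v, e (f u) (f v) -> v = ordS u].
Proof.
move=> Sx0 /(exists_closed_walk Sx0) /ex_minnP[L /andP[L_gt0 /existsP[f]]].
move=> /forallP fP Lmin.
(* [g] repeats [f] with period [L], so that walks may run past the index [L - 1]. *)
pose g t := f (Ordinal (ltn_pmod t L_gt0)).
have gE (l : 'I_L) : g l = f l.
  by congr (f _); apply: val_inj; rewrite /= modn_small.
have gEL (l : 'I_L) : g (l + L) = f l.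
  by congr (f _); apply: val_inj; rewrite /= modnDr modn_small.
have eg t : e (g t) (g t.+1).
  have -> : g t.+1 = f (ordS (Ordinal (ltn_pmod t L_gt0))); last exact: fP.
  by congr (f _); apply: val_inj; rewrite /= -addn1 -modnDml addn1.
(* The back edge closes the walk [g t], ..., [g (t + k)] on [k + 1] indices. *)
have shortcut t k : e (g (t + k)) (g t) -> L <= k.+1.
  move=> etk; apply/Lmin/(closed_walk_of_nat (g := fun s => g (t + s))) => //.
    by move=> s _; rewrite addnS.
  by rewrite addn0.
have f_inj_lt (u v : 'I_L) : u < v -> f u <> f v.
  move=> ltuv fuv; have := eg v.-1.
  rewrite prednK ?(leq_ltn_trans _ ltuv) // gE -fuv -gE.
  have -> : v.-1 = u + (v - u).-1 by lia.
  by move/shortcut; have := ltn_ord v; lia.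
exists L, f; split=> // u v.
  move=> fuv; apply: val_inj; case: (ltngtP u v) => // /f_inj_lt; first by [].
  by rewrite fuv.
move=> euv; apply: val_inj => /=; have uL := ltn_ord u; have vL := ltn_ord v.
(* The edge closes the walk from [v] up to [u], or up to [u + L] if [u < v]; minimality makes this
   walk use all [L] indices. *)
case: (leqP v u) => [le_vu|lt_uv].
  have /shortcut : e (g (v + (u - v))) (g v) by rewrite subnKC // !gE.
  move=> leL; have -> : (u : nat) = L.-1 by lia.
  by rewrite prednK // modnn; lia.
have /shortcut : e (g (v + (u + L - v))) (g v).
  by rewrite subnKC ?gEL ?gE //; lia.
move=> leL; have vE : (v : nat) = u.+1 by lia.
by rewrite -vE modn_small.
Qed.

End ChordlessCycle.

Local Open Scope ring_scope.

(* The weights [w j] stand for the differences [y j - x j]; where nonzero they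
   rescale columns, which preserves forbidden patterns. *)
Lemma has_forbidden_pattern_of_signs (R : realType) (m n : nat)
    (A : 'M[R]_(m, n)) (w : 'I_n -> R) (S : {pred 'I_n}) (j0 : 'I_n) :
  j0 \in S ->
  (forall j, j \in S -> exists i, A i j * w j < 0 /\
     exists2 k, k \in S & 0 < A i k * w k) ->
  has_forbidden_pattern A.
Proof.
move=> Sj0 signs.
pose e j k := [exists i, (A i j * w j < 0) && (0 < A i k * w k)].
have succ_ex j : j \in S -> exists2 k, k \in S & e j k.
  move=> /signs[i [neg [k Sk pos]]]; exists k => //.
  by apply/existsP; exists i; rewrite neg.
have [L [f [L_gt0 f_inj ef chordless]]] := exists_chordless_cycle Sj0 succ_ex.
have /fin_all_exists[r rP] : forall l, exists i,
    A i (f l) * w (f l) < 0 /\ 0 < A i (f (ordS l)) * w (f (ordS l)).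
  by move=> l; have /existsP[i /andP[]] := ef l; exists i.
(* A positive weighted entry of row [r u] at [f v] gives an edge from [f u] to [f v]; a negative one
   gives an edge from [f v] to [f (ordS u)]. Chordlessness then determines [v]. *)
have pos_ordS u v : 0 < A (r u) (f v) * w (f v) -> v = ordS u.
  move=> pos; apply: chordless; apply/existsP; exists (r u).
  by rewrite pos (rP u).1.
have neg_eq u v : A (r u) (f v) * w (f v) < 0 -> v = u.
  move=> neg; apply/esym/(can_inj (@ordSK L))/chordless/existsP.
  by exists (r u); rewrite neg (rP u).2.
have r_inj : injective r.
  by move=> u v ruv; apply/esym/neg_eq; rewrite ruv; case: (rP v).
(* The shift makes [i l] the row of the edge entering [f l], and [i (ordS l)] the row of the edge
   leaving it. *)
pose i := r \o @ord_pred L.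
have i_inj : injective i := inj_comp r_inj (can_inj (@ord_predK L)).
exists (i @: [set: 'I_L]), (f @: [set: 'I_L]), L; split.
- by rewrite -lt0n.
- by rewrite card_imset // cardsT card_ord.
- by rewrite card_imset // cardsT card_ord.
exists i, f; split=> // l.
have wl_neq0 : w (f l) != 0.
  by apply: contraTneq (rP l).1 => ->; rewrite mulr0 ltxx.
split=> [k|].
  rewrite !inE negb_or => /andP[/andP[k_neq1 k_neq2] /imsetP[u _ kE]].
  apply/eqP; rewrite -(mulIr_eq0 _ (mulIf wl_neq0)) kE.
  case: ltgtP => // [/neg_eq lu|/pos_ordS lu].
    by move: k_neq2; rewrite kE /i /= ordSK -lu eqxx.
  by move: k_neq1; rewrite kE lu ord_predK eqxx.
rewrite /i /= ordSK.
(* The two weighted entries have opposite signs, and their product contains the weight only as a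
   square. *)
have := (rP (ord_pred l)).2; rewrite ord_predK => pos.
have := nmulr_llt0 (A (r (ord_pred l)) (f l) * w (f l)) (rP l).1.
rewrite pos mulrACA pmulr_llt0 //.
by rewrite -expr2 exprn_even_gt0.
Qed.

Section UniversalConnectivity.

Variables (R : realType) (d m n : nat) (A : 'M[R]_(m, n)) (b : 'cV[R]_m).

Implicit Types x y : point d n.

Let move_to x y (j : 'I_n) : point d n := [ffun k => if k == j then y k else x k].

Let disp x y (k : 'I_n) : R := (y k : nat)%:R - (x k : nat)%:R.

Let row_value x y i :
  (A *m col_of_point R y) i 0 =
  (A *m col_of_point R x) i 0 + \sum_k A i k * disp x y k.
Proof.
rewrite !mxE -big_split /=; apply: eq_bigr => k _.
by rewrite !mxE -mulrDr addrC subrK.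
Qed.

Let row_value_move x y i j :
  (A *m col_of_point R (move_to x y j)) i 0 =
  (A *m col_of_point R x) i 0 + A i j * disp x y j.
Proof.
rewrite (row_value x) (bigD1 j) //= big1 ?addr0 => [|k /negPf neq_kj].
  by rewrite /disp ffunE eqxx.
by rewrite /disp ffunE neq_kj subrr mulr0.
Qed.

Lemma exists_feasible_move x y :
  ~ has_forbidden_pattern A -> x \in feasible d A b -> y \in feasible d A b ->
  x != y -> exists2 j, x j != y j & move_to x y j \in feasible d A b.
Proof.
move=> noFP; rewrite !inE => /forallP xF /forallP yF neq_xy.
have [j0 j0P] : exists j, x j != y j.
  apply/existsP; apply: contraNT neq_xy; rewrite negb_exists => /forallP eq_xy.
  by apply/eqP/ffunP => j; apply/eqP/negPn.
have [/existsP[j /andP[]]|/existsPn stuck] :=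
  boolP [exists j, (x j != y j) && (move_to x y j \in feasible d A b)].
  by exists j.
case: noFP; apply: (has_forbidden_pattern_of_signs (w := disp x y)
  (S := [pred j | x j != y j]) (j0 := j0)) => // j; rewrite inE => neq_j.
have := stuck j; rewrite neq_j inE /= => /forallPn[i].
rewrite row_value_move -ltNge => viol.
(* Row [i] holds at [x], so only a decrease can violate it. *)
have neg : A i j * disp x y j < 0.
  by have := lt_le_trans viol (xF i); rewrite gtrDl.
exists i; split=> //.
have [/existsP[k pos]|/existsPn nonpos] :=
  boolP [exists k, 0 < A i k * disp x y k].
  exists k => //; rewrite inE; apply: contraTneq pos => eq_k.
  by rewrite /disp eq_k subrr mulr0 ltxx.
(* Without a positive term, row [i] would be no larger at [y] than after the move, hence violated at
   [y]. *)
have := lt_le_trans viol (yF i).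
rewrite (row_value x y) ltrD2l (bigD1 j) //= ltrDl ltNge sumr_le0 // => k _.
by rewrite leNgt.
Qed.

(** Induction on the Hamming distance to [y], which each feasible move decreases. *)
Lemma solution_graph_connected_of_no_pattern :
  ~ has_forbidden_pattern A -> solution_graph_connected d A b.
Proof.
move=> noFP x y xF yF.
have [N] := ubnP (hamming x y); elim: N x xF => // N IH x xF ltN.
have [->|neq_xy] := eqVneq x y; first exact: connect0.
have [j neq_j mF] := exists_feasible_move noFP xF yF neq_xy.
apply: connect_trans (connect1 _) (IH _ mF _).
  rewrite /solution_graph xF mF /= /hamming.
  apply/cards1P; exists j; apply/setP => k; rewrite !inE ffunE.
  by have [->|] := eqVneq k j; rewrite ?neq_j ?eqxx.
move: ltN; rewrite ltnS; apply: leq_trans; apply/proper_card/properP; split.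
  by apply/subsetP => k; rewrite !inE ffunE; case: ifP; rewrite ?eqxx.
by exists j; rewrite !inE // ffunE !eqxx.
Qed.

End UniversalConnectivity.

Theorem theorem2 (R : realType) (d m n : nat) (A : 'M[R]_(m, n)) :
  (0 < d)%N ->
  (m <= 3)%N \/ (n <= 2)%N \/ (m = 4%N /\ n = 3%N) ->
  ~ has_forbidden_pattern A ->
  universally_connected d A.
Proof.
by move=> _ _ noFP b; apply: solution_graph_connected_of_no_pattern.
Qed.
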